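(* Let $\Gamma$ be a countable discrete group and let $\overline{\Gamma}$ be a $\Gamma$-compactification with minimal metrizable boundary $\partial\overline{\Gamma}=\overline{\Gamma}\setminus\Gamma$. Then there exists a $\Gamma$-equivariant retraction $\overline{\Gamma}\to\partial\overline{\Gamma}$ if and only if $\overline{\Gamma}$ is point-orbital.
   Context: A $\Gamma$-space is a (nonempty) compact Hausdorff space $X$ with an action of $\Gamma$ by homeomorphisms; it is minimal if it has no proper nonempty closed $\Gamma$-invariant subset. A $\Gamma$-compactification with boundary $X$ (a minimal compact $\Gamma$-space) is the disjoint union $\overline{\Gamma}=\Gamma\cup X$ with a topology $\tau$ such that: (1) $(\Gamma\cup X,\tau)$ is compact Hausdorff, $\Gamma$ is dense in it, and $\tau$ induces the discrete topology on $\Gamma$ and the original topology on $X$; (2) the left multiplication action of $\Gamma$ on $\Gamma$ and the action of $\Gamma$ on $X$ together define a continuous action of $\Gamma$ on $\Gamma\cup X$. A retraction $\overline{\Gamma}\to\partial\overline{\Gamma}$ is a continuous map which is the identity on $\partial\overline{\Gamma}$. For $x_0\in X$, let $\tau_{x_0}$ be the topology on $\Gamma\cup X$ in which a set $S$ is closed if and only if $S\cap X$ is closed in $X$ and, whenever $(\gamma_n)$ is a sequence in $S\cap\Gamma$ which leaves every finite subset of $\Gamma$ (i.e. for every finite $F\subset\Gamma$, $\gamma_n\notin F$ for all large $n$), $S$ contains every accumulation point in $X$ of the sequence $(\gamma_n x_0)$. Thus $\tau_{x_0}$ induces the discrete topology on $\Gamma$ and the original topology on $X$, and for a sequence $(\gamma_n)$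 in $\Gamma$ leaving every finite set and $x\in X$ one has $\gamma_n\to x$ iff $\gamma_n x_0\to x$. The $\Gamma$-compactification $(\Gamma\cup X,\tau)$ is point-orbital if $\tau=\tau_{x_0}$ for some $x_0\in X$. *)

(* Defs.v *)
From HB Require Import structures.
From mathcomp Require Import all_boot all_order all_algebra.
From mathcomp Require Import all_classical all_reals all_analysis.

Set Implicit Arguments.
Unset Strict Implicit.
Unset Printing Implicit Defensive.

Import Order.TTheory GRing.Theory Num.Theory.
Local Open Scope classical_set_scope.
Local Open Scope ring_scope.

(* A topology as a first-class object, so that one can speak of "a topology tau
   on G + X"; topologized tau is the corresponding topologicalType. *)
Record topology (T : Type) := Topology {
  opens : set_system T ;
  opensT : opens setT ;
  opensI : setI_closed opens ;
  opens_bigU : forall (I : Type) (f : I -> set T),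
    (forall i, opens (f i)) -> opens (\bigcup_i f i) }.

Definition topologized (T : Type) (tau : topology T) : Type := T.

HB.instance Definition _ (T : choiceType) (tau : topology T) :=
  Choice.copy (topologized tau) T.
HB.instance Definition _ (T : choiceType) (tau : topology T) :=
  isOpenTopological.Build (topologized tau)
    (opensT tau) (@opensI _ tau) (@opens_bigU _ tau).

Definition metrizable (R : realType) (X : topologicalType) : Prop :=
  exists d : X -> X -> R,
    [/\ forall x y, 0 <= d x y,
        forall x y, d x y = 0 <-> x = y,
        forall x y, d x y = d y x,
        forall x y z, d x z <= d x y + d y z &
        forall x (A : set X),
          nbhs x A <-> exists2 e : R, 0 < e & [set y | d x y < e] `<=` A].

(* Each translation is a homeomorphism, since the inverse of act g is the
   continuous map act g^-1. *)
Record Gspace (G : groupType) (X : topologicalType) (act : G -> X -> X) :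
    Prop := {
  Gspace_neq0 : [set: X] !=set0 ;
  Gspace_compact : compact [set: X] ;
  Gspace_hausdorff : hausdorff_space X ;
  Gspace_act1 : forall x, act 1%g x = x ;
  Gspace_actM : forall g h x, act (g * h)%g x = act g (act h x) ;
  Gspace_continuous : forall g, continuous (act g) }.

Definition minimal_action (G : groupType) (X : topologicalType)
    (act : G -> X -> X) : Prop :=
  forall A : set X, closed A -> A !=set0 ->
    (forall g, act g @` A `<=` A) -> A = setT.

Definition ext_act (G : groupType) (X : Type) (act : G -> X -> X) (g : G)
    (z : G + X) : G + X :=
  match z with
  | inl h => inl (g * h)%g
  | inr x => inr (act g x)
  end.

(* G is discrete, so continuity of the action on G + X means that every
   translation is continuous. *)
Record compactification (G : groupType) (X : topologicalType)
    (act : G -> X -> X) (tau : topology (G + X)%type) : Prop := {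
  cpt_compact : compact [set: topologized tau] ;
  cpt_hausdorff : hausdorff_space (topologized tau) ;
  cpt_dense : dense (range (inl : G -> topologized tau)) ;
  cpt_discrete : forall A : set G,
    open (A : set (initial_topology (inl : G -> topologized tau))) ;
  cpt_boundary : forall A : set X,
    open (A : set (initial_topology (inr : X -> topologized tau))) <-> open A ;
  cpt_continuous : forall g,
    continuous (ext_act act g : topologized tau -> topologized tau) }.

Definition retraction (G : groupType) (X : topologicalType)
    (tau : topology (G + X)%type) (r : topologized tau -> X) : Prop :=
  continuous r /\ forall x, r (inr x) = x.

Definition equivariant (G : groupType) (X : topologicalType)
    (act : G -> X -> X) (r : G + X -> X) : Prop :=
  forall g z, r (ext_act act g z) = act g (r z).

Definition leaves_finite (G : Type) (u : nat -> G) : Prop :=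
  forall F : set G, finite_set F -> \forall n \near \oo, ~ F (u n).

(* The closed sets of the topology tau_{x0}. *)
Definition orbital_closed (G : groupType) (X : topologicalType)
    (act : G -> X -> X) (x0 : X) (S : set (G + X)) : Prop :=
  closed (inr @^-1` S) /\
  forall u : nat -> G, (forall n, S (inl (u n))) -> leaves_finite u ->
    forall y : X, cluster ((fun n => act (u n) x0) @ \oo) y -> S (inr y).

Definition point_orbital (G : groupType) (X : topologicalType)
    (act : G -> X -> X) (tau : topology (G + X)%type) : Prop :=
  exists x0 : X, forall S : set (topologized tau),
    closed S <-> orbital_closed act x0 S.

(* Main.v *)
Require Import Defs.
From HB Require Import structures.
From mathcomp Require Import all_boot all_order all_algebra.
From mathcomp Require Import all_classical all_reals all_analysis.

Local Open Scope classical_set_scope.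

(** An equivariant retraction [r] is determined on the group by the boundary
    point [x0 := r 1], since [r g = g x0]; conversely every [x0] in the boundary
    defines an equivariant map that is [g |-> g x0] on the group and the
    identity on the boundary. The theorem compares the continuity of this map
    with the equality of [tau] and the orbital topology of [x0].

    If [tau] is the orbital topology of [x0], the map is continuous: when [C] is
    closed in the boundary, a sequence [u] in its preimage has all [u n x0] in
    [C], hence so are the accumulation points, and the preimage of [C] meets the
    orbital criterion for closed sets.

    Assume now that the map is a continuous retraction [r].
    - A [tau]-closed set is orbitally closed: if [u] leaves every finite set, a
      cluster point [y] of [u n x0 = r (u n)] is also a cluster point of [u]
      itself in the compactification ([cluster_retraction]). By compactness the
      terms [u n] with [r (u n)] near [y] accumulate somewhere; not in the
      group, whose points are isolated ([compactification_open_inl]), so at a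
      boundary point, which [r] fixes and which is therefore [y].
    - An orbitally closed set [S] is [tau]-closed: its boundary part is compact,
      and if a boundary point [x] adheres to its group part, then countability
      of the group and metrizability of the boundary provide a sequence [u] in
      [S] that leaves every finite set with [r (u n) = u n x0] tending to [x]
      ([exists_leaves_finite_cvg]), so [x] is in [S]. *)

(** A discrete dense subspace of a Hausdorff space consists of isolated points:
    if the open set [U] isolates [g] within the group, then [U] minus [g] is an
    open set that misses the group, so it is empty. *)
Lemma compactification_open_inl {G : groupType} {X : topologicalType}
    {act : G -> X -> X} {tau : topology (G + X)%type} (g : G) :
  compactification act tau -> open [set (inl g : topologized tau)].
Proof.
move=> cptK; have [U Uop Ug] := cpt_discrete cptK [set g].
suff -> : [set (inl g : topologized tau)] = U by [].
have UG h : U (inl h) <-> h = g.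
  by rewrite (_ : U (inl h) = (inl @^-1` U) h) // Ug.
apply/seteqP; split => [z ->|z Uz]; first exact/UG.
apply: contrapT => /= zg.
have gclosed : closed [set (inl g : topologized tau)].
  exact/accessible_closed_set1/hausdorff_accessible/(cpt_hausdorff cptK).
have [|y [[Uy yg] [h _ hy]]] :=
  cpt_dense cptK (ex_intro _ z (conj Uz zg) : U `&` ~` [set inl g] !=set0).
  by apply: openI => //; exact: closed_openC.
by move: Uy yg; rewrite -hy => /UG -> [].
Qed.

Lemma compactification_continuous_inr {G : groupType} {X : topologicalType}
    {act : G -> X -> X} {tau : topology (G + X)%type} :
  compactification act tau -> continuous (inr : X -> topologized tau).
Proof.
by move=> cptK; apply/continuousP => A Aop; apply/(cpt_boundary cptK); exists A.
Qed.

(** Compactness makes a retraction reflect accumulation at boundary points,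
    along sequences that leave every finite set. *)
Lemma cluster_retraction {G : groupType} {X : topologicalType}
    {act : G -> X -> X} {tau : topology (G + X)%type}
    {r : topologized tau -> X} {u : nat -> G} {y : X} :
  hausdorff_space X -> compactification act tau -> retraction r ->
  leaves_finite u ->
  cluster ((fun n => r (inl (u n))) @ \oo) y ->
  cluster ((fun n => inl (u n) : topologized tau) @ \oo) (inr y).
Proof.
move=> hX cptK [rcont rX] ufin yclu.
(* The image under [u] of the filter generated by the tails of nat and the sets
   of those n with [r (u n)] close to [y]; it is proper because [y] is a cluster
   point. *)
pose Phi : set_system (topologized tau) := [set A | exists P V,
  [/\ (\oo : set_system nat) P, nbhs y V &
      forall n, P n -> V (r (inl (u n))) -> A (inl (u n))]].
have PhiF : ProperFilter Phi.
  apply: Build_ProperFilter_ex.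
    move=> A [P [V [Poo Vy PVA]]].
    have [|_ [[n Pn <-] Vn]] := yclu ((fun n => r (inl (u n))) @` P) V _ Vy.
      by apply: filterS Poo => n Pn; exists n.
    by exists (inl (u n)); exact: PVA.
  split.
  - by exists setT, setT; split => //; exact: filterT.
  - move=> A B [P [V [Poo Vy PVA]]] [Q [W [Qoo Wy QWB]]].
    exists (P `&` Q), (V `&` W); split; [exact: filterI|exact: filterI|].
    by move=> n [Pn Qn] [Vn Wn]; split; [exact: PVA|exact: QWB].
  - move=> A B AB [P [V [Poo Vy PVA]]]; exists P, V; split => // n Pn Vn.
    exact/AB/PVA.
have [z [_ zclu]] := cpt_compact cptK PhiF filterT.
case: z zclu => [g|x] zclu.
  have Phig : Phi (~` [set inl g]).
    exists (fun n => ~ [set g] (u n)), setT; split; first exact: ufin.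
      exact: filterT.
    by move=> n ung _ [].
  have gnbhs : nbhs (inl g : topologized tau) [set inl g].
    by apply: open_nbhs_nbhs; split => //; exact: compactification_open_inl cptK.
  by have [w []] := zclu _ _ Phig gnbhs.
have <- : x = y.
  apply: hX => A B Ax By.
  have PhiB : Phi (r @^-1` B).
    by exists setT, B; split => //; exact: filterT.
  have Arx : nbhs (inr x : topologized tau) (r @^-1` A).
    by apply: rcont; rewrite rX.
  by have [w [Bw Aw]] := zclu _ _ PhiB Arx; exists (r w).
move=> A B Aoo Bx; apply: zclu => //.
by exists ((fun n => inl (u n)) @^-1` A), setT; split => //; exact: filterT.
Qed.

(** With [f] an injection of a countable [G] into nat, this produces sequences
    that leave every finite set. *)
Lemma leaves_finite_of_code_ge {G : Type} (f : G -> nat) {u : nat -> G} :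
  (forall n, (n <= f (u n))%N) -> leaves_finite u.
Proof.
move=> fu F /(finite_image f) fF.
have [s Fs] := (finite_seqP _).1 fF.
exists (\max_(k <- s) k).+1 => // n /= sn Fun.
have fus : f (u n) \in s.
  suff: [set` s] (f (u n)) by [].
  by rewrite -Fs; exists (u n).
have := leq_bigmax_seq (P := xpredT) (F := id) _ fus isT.
by rewrite leqNgt (leq_trans sn (fu n)).
Qed.

(** The n-th term is chosen in [S] with [r]-value at distance less than
    [1 / n.+1] from [r x], and outside the finitely many elements that a fixed
    injection of [G] into nat maps below n. Avoiding these is possible because finite sets are closed in [Y] and
    [x] is not in the image of [i]. *)
Lemma exists_leaves_finite_cvg {R : realType} {G : choiceType}
    {Y X : topologicalType} {i : G -> Y} {r : Y -> X} {S : set G} {x : Y} :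
  countable [set: G] -> metrizable R X -> accessible_space Y ->
  {for x, continuous r} -> (forall g, i g <> x) ->
  closure (i @` S) x ->
  exists u : nat -> G, [/\ forall n, S (u n), leaves_finite u &
    (fun n => r (i (u n))) @ \oo --> r x].
Proof.
move=> /countable_injP[f finj] [d [_ _ _ _ dnbhs]] Y1 rx ix Sx.
have step n : exists g, [/\ S g, (n <= f g)%N &
    (d (r x) (r (i g)) < n.+1%:R^-1)%R].
  have [|_ [[g Sg <-] [gd gf]]] :=
    Sx ((r @^-1` [set y | (d (r x) y < n.+1%:R^-1)%R]) `&`
        ~` (i @` [set g | (f g < n)%N])).
    apply: filterI.
      by apply: rx; apply/dnbhs; exists (n.+1%:R^-1)%R => //; rewrite invr_gt0.
    apply: open_nbhs_nbhs; split; last by move=> [g _ /ix].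
    apply: closed_openC; apply: (accessible_finite_set_closed.1 Y1).
    apply/finite_image/(finite_preimage (B := `I_n)) => //.
    by move=> g h _ _; apply: finj; rewrite in_setT.
  exists g; split => //; rewrite leqNgt; apply/negP => gn; apply: gf.
  by exists g.
have [u uP] := choice step.
exists u; split=> [n||]; first by have [] := uP n.
  by apply: (leaves_finite_of_code_ge f) => n; have [] := uP n.
move=> A /dnbhs[e e0 eA].
apply: filterS (near_infty_natSinv_lt (PosNum e0)) => n ne; apply: eA.
by have [_ _ /Order.POrderTheory.lt_trans] := uP n; apply.
Qed.

Theorem theorem1p2 (R : realType) (G : groupType) (X : topologicalType)
    (act : G -> X -> X) (tau : topology (G + X)%type)
    (countableG : countable [set: G])
    (GspaceX : Gspace act)
    (minimalX : minimal_action act)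
    (metrizableX : metrizable R X)
    (cptK : compactification act tau) :
  (exists r : topologized tau -> X, retraction r /\ equivariant act r) <->
  point_orbital act tau.
Proof.
split=> [[r [rretr requi]]|[x0 x0P]].
  have [rcont rX] := rretr.
  have inrC := compactification_continuous_inr cptK.
  have rE (u : nat -> G) :
      (fun n => act (u n) (r (inl 1%g))) = (fun n => r (inl (u n))).
    by apply/funext => n; rewrite -requi /= mulg1.
  exists (r (inl 1%g)) => S; split=> [Scl|[SXcl Sorb]].
    split.
      by apply: (continuous_closedP (inr : X -> topologized tau)).1 Scl.
    move=> u uS ufin y; rewrite rE => yclu; apply: (Scl (inr y)) => B By.
    have := cluster_retraction (Gspace_hausdorff GspaceX) cptK rretr
      ufin yclu.
    by apply => //; exists 0%N => // n _; exact: uS.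
  have -> : S = inl @` (inl @^-1` S) `|` inr @` (inr @^-1` S).
    apply/seteqP; split=> [[g|x] Sz|_ [[g Sg <-]|[x Sx <-]]] //.
      by left; exists g.
    by right; exists x.
  move=> z; rewrite closureU => -[Sz|].
    case: z Sz => [g|x] Sz.
      have [|_ [[h Sh <-] [hg]]] := Sz [set (inl g : topologized tau)].
        apply: open_nbhs_nbhs; split => //.
        exact: compactification_open_inl cptK.
      by left; rewrite -hg; exists h.
    have tau1 := hausdorff_accessible (cpt_hausdorff cptK).
    have [//|u [uS ufin ucvg]] := exists_leaves_finite_cvg
      countableG metrizableX tau1 (rcont (inr x)) _ Sz.
    rewrite rX in ucvg; right; exists x => //; apply: (Sorb u) => //.
    rewrite rE; move=> A B uA /ucvg uB; exact: filter_ex (filterI uA uB).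
  suff invcl : closed (inr @` (inr @^-1` S) : set (topologized tau)).
    by move/invcl; right.
  apply: compact_closed; first exact: cpt_hausdorff cptK.
  apply: continuous_compact; first exact: continuous_subspaceT.
  exact: subclosed_compact SXcl (Gspace_compact GspaceX) _.
exists (fun z => match z with inl g => act g x0 | inr x => x end).
split; last first.
  by case: GspaceX => _ _ _ _ actM _; move=> g [h|x] /=.
split=> //; apply/continuous_closedP => C Ccl; apply/x0P; split=> //=.
move=> u uC _ y yclu; apply: Ccl => B By.
by apply: yclu => //; exists 0%N => // n _; exact: uC.
Qed.
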